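(* (Distributivity fails in D.LL.) The translation of the distributivity axiom $A\wedge(B\vee C)\vdash(A\wedge B)\vee(A\wedge C)$ is not derivable in D.LL. That is, for pairwise distinct atomic propositions $A,B,C$, the multi-type sequent $(A\wedge(B\vee C))^\tau\vdash((A\wedge B)\vee(A\wedge C))_\tau$, namely $$◆\big(\Box A^\tau\cap\Box ◆(\Box B^\tau\cup\Box C^\tau)\big)\vdash\blacksquare\big(\Diamond\blacksquare(\Diamond A_\tau\cap\Diamond B_\tau)\cup\Diamond\blacksquare(\Diamond A_\tau\cap\Diamond C_\tau)\big),$$ is not derivable in D.LL.
   Context: **Lattice logic language.** $\mathcal{L}$ over a set $\mathsf{AtProp}$ of atomic propositions: $A::=p\mid\top\mid\bot\mid A\wedge A\mid A\vee A$. **Language of D.LL** over $\mathsf{AtProp}$. There are three types $\mathsf{L}$ (Lattice), $\mathsf{P}$ (Left), $\mathsf{P}^{\mathrm{op}}$ (Right), each with formulas and structures. - Type $\mathsf{L}$: formulas $A::=p\mid\top\mid\bot\mid ◆\alpha\mid\blacksquare\xi$; structures $X::=A\mid \mathrm{I}\mid\bullet\Gamma\mid\bullet\Pi$. - Type $\mathsf{P}$: formulas $\alpha::=\Box A\mid\alpha\cap\alpha\mid\alpha\cup\alpha$; structures $\Gamma::=\alpha\mid\circ X\mid\circledS\mid\Gamma\cdot\Gamma\mid\Gamma\supset\Gamma$. - Type $\mathsf{P}^{\mathrm{op}}$: formulas $\xi::=\Diamond A\mid\xi\cap\xi\mid\xi\cup\xi$; structures $\Pi::=\xi\mid\circ X\mid\circledS\mid\Pi\cdot\Pi\mid\Pi\supset\Pi$.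 (The connectives $\cap,\cup,\circledS,\cdot,\supset$ of type $\mathsf{P}^{\mathrm{op}}$ carry a superscript $^{\mathrm{op}}$ which is suppressed.) A sequent $x\vdash y$ has $x,y$ structures of the same type. In $x\vdash y$, $x$ is in precedent position and $y$ in succedent position; substructures inherit the position of the parent, except that the first argument of $\supset$ has the opposite position. Only sequents are considered in which $\circ X$ of type $\mathsf{P}$ and $\bullet\Pi$ occur only in succedent position, and $\circ X$ of type $\mathsf{P}^{\mathrm{op}}$ and $\bullet\Gamma$ occur only in precedent position. **Rules of D.LL.** Notation: ''premises / conclusion''; ''//'' denotes a double-line rule, usable in both directions. $X,Y$ are $\mathsf{L}$-structures, $\Gamma$ a $\mathsf{P}$-structure, $\Pi$ a $\mathsf{P}^{\mathrm{op}}$-structure. In the pure-type rules $S,T,U,V$ are structures and $s,t$ formulas, all of the same type, which is either $\mathsf{P}$ or $\mathsf{P}^{\mathrm{op}}$. - Multi-type display rules: $\Gamma\vdash\circ X$ // $\bullet\Gamma\vdash X$; $\ \circ X\vdash\Pi$ // $X\vdash\bullet\Pi$. - Pure $\mathsf{P}$/$\mathsf{P}^{\mathrm{op}}$ display rules: $S\cdot T\vdash U$ // $T\vdash S\supset U$; $\ S\vdash T\cdot U$ // $T\supset S\vdash U$. - Pure $\mathsf{P}$/$\mathsf{P}^{\mathrm{op}}$ structural rules. Cut: $S\vdash s$, $s\vdash T$ / $S\vdash T$. Unit: $S\vdash T$ // $S\cdot\circledS\vdash T$; $S\vdash T$ // $S\vdash T\cdot\circledS$. Exchange: $S\cdot T\vdash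 U$ / $T\cdot S\vdash U$; $S\vdash T\cdot U$ / $S\vdash U\cdot T$. Associativity: $(S\cdot T)\cdot U\vdash V$ // $S\cdot(T\cdot U)\vdash V$; $S\vdash(T\cdot U)\cdot V$ // $S\vdash T\cdot(U\cdot V)$. Weakening: $S\vdash T$ / $S\cdot U\vdash T$; $S\vdash T$ / $S\vdash T\cdot U$. Contraction: $S\cdot S\vdash T$ / $S\vdash T$; $S\vdash T\cdot T$ / $S\vdash T$. - Pure $\mathsf{P}$/$\mathsf{P}^{\mathrm{op}}$ operational rules: $s\cdot t\vdash S$ / $s\cap t\vdash S$; $\ S\vdash s$, $T\vdash t$ / $S\cdot T\vdash s\cap t$; $\ s\vdash S$, $t\vdash T$ / $s\cup t\vdash S\cdot T$; $\ S\vdash s\cdot t$ / $S\vdash s\cup t$. - Pure $\mathsf{L}$ rules. Id: $p\vdash p$ (axiom, $p$ atomic). Cut: $X\vdash A$, $A\vdash Y$ / $X\vdash Y$. $\mathrm{I}$-weakening: $\mathrm{I}\vdash X$ / $Y\vdash X$; $X\vdash\mathrm{I}$ / $X\vdash Y$. Constants: $\mathrm{I}\vdash X$ / $\top\vdash X$; $\mathrm{I}\vdash\top$ (axiom); $\bot\vdash\mathrm{I}$ (axiom); $X\vdash\mathrm{I}$ / $X\vdash\bot$. - Operational rules for multi-type connectives: $\circ A\vdash\Pi$ / $\Diamond A\vdash\Pi$; $\ X\vdash A$ / $\circ X\vdash\Diamond A$ (type $\mathsf{P}^{\mathrm{op}}$); $\ X\vdash\bullet\xi$ / $X\vdash\blacksquare\xi$;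 $\ \xi\vdash\Pi$ / $\blacksquare\xi\vdash\bullet\Pi$; $\ \bullet\alpha\vdash X$ / $◆\alpha\vdash X$; $\ \Gamma\vdash\alpha$ / $\bullet\Gamma\vdash ◆\alpha$; $\ \Gamma\vdash\circ A$ / $\Gamma\vdash\Box A$; $\ A\vdash X$ / $\Box A\vdash\circ X$ (type $\mathsf{P}$). **Translations** from $\mathcal{L}$-formulas to $\mathsf{L}$-type formulas of D.LL: $\top^\tau=◆\Box\top$, $\bot^\tau=◆\Box\bot$, $p^\tau=◆\Box p$, $(A\wedge B)^\tau=◆(\Box A^\tau\cap\Box B^\tau)$, $(A\vee B)^\tau=◆(\Box A^\tau\cup\Box B^\tau)$; and $\top_\tau=\blacksquare\Diamond\top$, $\bot_\tau=\blacksquare\Diamond\bot$, $p_\tau=\blacksquare\Diamond p$, $(A\wedge B)_\tau=\blacksquare(\Diamond A_\tau\cap\Diamond B_\tau)$, $(A\vee B)_\tau=\blacksquare(\Diamond A_\tau\cup\Diamond B_\tau)$ (with $\cap,\cup$ of type $\mathsf{P}^{\mathrm{op}}$ in the second group). *)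

(* Defs.v *)
From Stdlib Require Import List.
Import ListNotations.

Set Implicit Arguments.
Unset Strict Implicit.
Unset Printing Implicit Defensive.

(* The two pure types P and P^op share all of their pure rules, so they are
   the values [TP Left] and [TP Right] of one family. *)
Inductive side : Type := Left | Right.
Inductive type : Type := TL | TP (o : side).

Notation P := (TP Left).
Notation Pop := (TP Right).

(* [BDia] and [BBox] are the black diamond and the black box. *)
Inductive form (AtProp : Type) : type -> Type :=
| Atom (p : AtProp) : form AtProp TL
| Top : form AtProp TL
| Bot : form AtProp TL
| BDia (alpha : form AtProp P) : form AtProp TL
| BBox (xi : form AtProp Pop) : form AtProp TL
| Box (A : form AtProp TL) : form AtProp P
| Dia (A : form AtProp TL) : form AtProp Pop
| Cap (o : side) (s t : form AtProp (TP o)) : form AtProp (TP o)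
| Cup (o : side) (s t : form AtProp (TP o)) : form AtProp (TP o).

Arguments Top {AtProp}.
Arguments Bot {AtProp}.

(* [Bullet] and [Circ] each stand for two structural connectives, one for each
   pure type; [Unit] is the structural constant written as a circled S. *)
Inductive struct (AtProp : Type) : type -> Type :=
| Fm (t : type) (A : form AtProp t) : struct AtProp t
| I : struct AtProp TL
| Bullet (o : side) (S : struct AtProp (TP o)) : struct AtProp TL
| Circ (o : side) (X : struct AtProp TL) : struct AtProp (TP o)
| Unit (o : side) : struct AtProp (TP o)
| Dot (o : side) (S T : struct AtProp (TP o)) : struct AtProp (TP o)
| Imp (o : side) (S T : struct AtProp (TP o)) : struct AtProp (TP o).

Arguments I {AtProp}.
Arguments Circ {AtProp} o X.
Arguments Unit {AtProp o}.

Coercion Fm : form >-> struct.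

Inductive sequent (AtProp : Type) : Type :=
| Seq (t : type) (x y : struct AtProp t).

Declare Scope dll_scope.
Delimit Scope dll_scope with dll.
Bind Scope dll_scope with form struct sequent.
Infix "∩" := Cap (at level 40, left associativity) : dll_scope.
Infix "∪" := Cup (at level 50, left associativity) : dll_scope.
Infix "·" := Dot (at level 55, left associativity) : dll_scope.
Infix "⊃" := Imp (at level 60, right associativity) : dll_scope.
Notation "x ⊢ y" := (Seq x y) (at level 70, no associativity) : dll_scope.
Local Open Scope dll_scope.

Inductive position : Type := Precedent | Succedent.

Definition opposite (d : position) : position :=
  match d with Precedent => Succedent | Succedent => Precedent end.

Definition bullet_position (o : side) : position :=
  match o with Left => Precedent | Right => Succedent end.

Definition circ_position (o : side) : position :=
  match o with Left => Succedent | Right => Precedent end.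

Fixpoint well_positioned (AtProp : Type) (d : position) (t : type)
    (x : struct AtProp t) : Prop :=
  match x with
  | Fm _ | I | Unit => True
  | @Bullet _ o y => d = bullet_position o /\ well_positioned d y
  | Circ o y => d = circ_position o /\ well_positioned d y
  | Dot y z => well_positioned d y /\ well_positioned d z
  | Imp y z => well_positioned (opposite d) y /\ well_positioned d z
  end.

Definition admissible (AtProp : Type) (q : sequent AtProp) : Prop :=
  match q with
  | x ⊢ y => well_positioned Precedent x /\ well_positioned Succedent y
  end.

(* [double_rule p q]: the double-line rule with [p] above and [q] below. *)
Inductive double_rule (AtProp : Type) : sequent AtProp -> sequent AtProp -> Prop :=
| display_bullet_circ (G : struct AtProp P) (X : struct AtProp TL) :
    double_rule (G ⊢ Circ Left X) (Bullet G ⊢ X)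
| display_circ_bullet (X : struct AtProp TL) (Q : struct AtProp Pop) :
    double_rule (Circ Right X ⊢ Q) (X ⊢ Bullet Q)
| display_l (o : side) (S T U : struct AtProp (TP o)) :
    double_rule (S · T ⊢ U) (T ⊢ S ⊃ U)
| display_r (o : side) (S T U : struct AtProp (TP o)) :
    double_rule (S ⊢ T · U) (T ⊃ S ⊢ U)
| unit_l (o : side) (S T : struct AtProp (TP o)) :
    double_rule (S ⊢ T) (S · Unit ⊢ T)
| unit_r (o : side) (S T : struct AtProp (TP o)) :
    double_rule (S ⊢ T) (S ⊢ T · Unit)
| assoc_l (o : side) (S T U V : struct AtProp (TP o)) :
    double_rule ((S · T) · U ⊢ V) (S · (T · U) ⊢ V)
| assoc_r (o : side) (S T U V : struct AtProp (TP o)) :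
    double_rule (S ⊢ (T · U) · V) (S ⊢ T · (U · V)).

Inductive rule (AtProp : Type) : list (sequent AtProp) -> sequent AtProp -> Prop :=
| rule_down (p q : sequent AtProp) : double_rule p q -> rule [p] q
| rule_up (p q : sequent AtProp) : double_rule p q -> rule [q] p
(* pure P and P^op structural rules *)
| cut_P (o : side) (S T : struct AtProp (TP o)) (s : form AtProp (TP o)) :
    rule [S ⊢ s; s ⊢ T] (S ⊢ T)
| exchange_l (o : side) (S T U : struct AtProp (TP o)) :
    rule [S · T ⊢ U] (T · S ⊢ U)
| exchange_r (o : side) (S T U : struct AtProp (TP o)) :
    rule [S ⊢ T · U] (S ⊢ U · T)
| weakening_l (o : side) (S T U : struct AtProp (TP o)) :
    rule [S ⊢ T] (S · U ⊢ T)
| weakening_r (o : side) (S T U : struct AtProp (TP o)) :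
    rule [S ⊢ T] (S ⊢ T · U)
| contraction_l (o : side) (S T : struct AtProp (TP o)) :
    rule [S · S ⊢ T] (S ⊢ T)
| contraction_r (o : side) (S T : struct AtProp (TP o)) :
    rule [S ⊢ T · T] (S ⊢ T)
(* pure P and P^op operational rules *)
| cap_l (o : side) (s t : form AtProp (TP o)) (S : struct AtProp (TP o)) :
    rule [s · t ⊢ S] (s ∩ t ⊢ S)
| cap_r (o : side) (s t : form AtProp (TP o)) (S T : struct AtProp (TP o)) :
    rule [S ⊢ s; T ⊢ t] (S · T ⊢ s ∩ t)
| cup_l (o : side) (s t : form AtProp (TP o)) (S T : struct AtProp (TP o)) :
    rule [s ⊢ S; t ⊢ T] (s ∪ t ⊢ S · T)
| cup_r (o : side) (s t : form AtProp (TP o)) (S : struct AtProp (TP o)) :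
    rule [S ⊢ s · t] (S ⊢ s ∪ t)
(* pure L rules *)
| id_L (p : AtProp) : rule [] (Atom p ⊢ Atom p)
| cut_L (X Y : struct AtProp TL) (A : form AtProp TL) :
    rule [X ⊢ A; A ⊢ Y] (X ⊢ Y)
| I_weakening_l (X Y : struct AtProp TL) : rule [I ⊢ X] (Y ⊢ X)
| I_weakening_r (X Y : struct AtProp TL) : rule [X ⊢ I] (X ⊢ Y)
| top_l (X : struct AtProp TL) : rule [I ⊢ X] (Top ⊢ X)
| top_r : rule [] (I ⊢ Top)
| bot_l : rule [] (Bot ⊢ I)
| bot_r (X : struct AtProp TL) : rule [X ⊢ I] (X ⊢ Bot)
(* operational rules for the multi-type connectives *)
| dia_l (A : form AtProp TL) (Q : struct AtProp Pop) :
    rule [Circ Right A ⊢ Q] (Dia A ⊢ Q)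
| dia_r (A : form AtProp TL) (X : struct AtProp TL) :
    rule [X ⊢ A] (Circ Right X ⊢ Dia A)
| bbox_r (xi : form AtProp Pop) (X : struct AtProp TL) :
    rule [X ⊢ Bullet xi] (X ⊢ BBox xi)
| bbox_l (xi : form AtProp Pop) (Q : struct AtProp Pop) :
    rule [xi ⊢ Q] (BBox xi ⊢ Bullet Q)
| bdia_l (alpha : form AtProp P) (X : struct AtProp TL) :
    rule [Bullet alpha ⊢ X] (BDia alpha ⊢ X)
| bdia_r (alpha : form AtProp P) (G : struct AtProp P) :
    rule [G ⊢ alpha] (Bullet G ⊢ BDia alpha)
| box_r (A : form AtProp TL) (G : struct AtProp P) :
    rule [G ⊢ Circ Left A] (G ⊢ Box A)
| box_l (A : form AtProp TL) (X : struct AtProp TL) :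
    rule [A ⊢ X] (Box A ⊢ Circ Left X).

(* Every sequent of a derivation has to be admissible, not only the last one. *)
Inductive derivable (AtProp : Type) : sequent AtProp -> Prop :=
| derive (ps : list (sequent AtProp)) (q : sequent AtProp) :
    rule ps q -> admissible q ->
    (forall p, In p ps -> derivable p) -> derivable q.

Inductive lform (AtProp : Type) : Type :=
| LAtom (p : AtProp)
| LTop
| LBot
| LAnd (A B : lform AtProp)
| LOr (A B : lform AtProp).

Arguments LTop {AtProp}.
Arguments LBot {AtProp}.

Declare Scope lform_scope.
Delimit Scope lform_scope with lform.
Bind Scope lform_scope with lform.
Infix "∧" := LAnd (at level 40, left associativity) : lform_scope.
Infix "∨" := LOr (at level 50, left associativity) : lform_scope.

(* The superscript translation, used for precedents. *)
Fixpoint tau_sup (AtProp : Type) (A : lform AtProp) : form AtProp TL :=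
  match A with
  | LAtom p => BDia (Box (Atom p))
  | LTop => BDia (Box Top)
  | LBot => BDia (Box Bot)
  | LAnd B C => BDia (Box (tau_sup B) ∩ Box (tau_sup C))
  | LOr B C => BDia (Box (tau_sup B) ∪ Box (tau_sup C))
  end.

(* The subscript translation, used for succedents. *)
Fixpoint tau_sub (AtProp : Type) (A : lform AtProp) : form AtProp TL :=
  match A with
  | LAtom p => BBox (Dia (Atom p))
  | LTop => BBox (Dia Top)
  | LBot => BBox (Dia Bot)
  | LAnd B C => BBox (Dia (tau_sub B) ∩ Dia (tau_sub C))
  | LOr B C => BBox (Dia (tau_sub B) ∪ Dia (tau_sub C))
  end.

Fact distributivity_translation (AtProp : Type) (a b c : AtProp)
    (A := LAtom a) (B := LAtom b) (C := LAtom c) :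
  (tau_sup (A ∧ (B ∨ C)) ⊢ tau_sub ((A ∧ B) ∨ (A ∧ C))) =
  (BDia (Box (tau_sup A) ∩ Box (BDia (Box (tau_sup B) ∪ Box (tau_sup C)))) ⊢
   BBox (Dia (BBox (Dia (tau_sub A) ∩ Dia (tau_sub B))) ∪
         Dia (BBox (Dia (tau_sub A) ∩ Dia (tau_sub C))))).
Proof. reflexivity. Qed.

(* Main.v *)
From Stdlib Require Import Classical List.
Require Import Defs.

Set Implicit Arguments.
Unset Strict Implicit.
Unset Printing Implicit Defensive.

(** The calculus is sound for a model whose lattice of type [TL] is not
    distributive, and the translated axiom fails there.

    Points are the atomic propositions themselves.  A formula or structure of
    any of the three types denotes a set of points, and a sequent denotes
    inclusion.  The types [TP Left] and [TP Right] range over the full Boolean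
    algebra of sets of points, which validates the pure rules.  The type [TL]
    ranges over the closed sets of the closure operator induced by the
    relation of being distinct: every pair of distinct points has the whole
    space as its closure, so the closed sets are the empty set, the
    singletons and the whole space (as soon as there are two points).  With
    three atoms this is the lattice M3, extended by one atom for every
    further point, and an atomic proposition denotes its own singleton.

    [soundness] says that derivable sequents are valid.  Both translations
    denote in this model what the lattice formula does: [join_full] makes
    [b ∨ c] the whole space, hence the precedent [a ∧ (b ∨ c)] contains the
    point [a], while [meet_empty] makes [a ∧ b] and [a ∧ c] empty, hence the
    succedent does not contain [a]. *)

(** * The model *)

Section Model.

Variable AtProp : Type.

Implicit Types (U V : AtProp -> Prop) (j m p q : AtProp).

Definition distinct_from_some U m : Prop := exists j, U j /\ j <> m.

Definition distinct_within U j : Prop := forall m, j <> m -> U m.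

Definition closure U : AtProp -> Prop := distinct_within (distinct_from_some U).

Definition stable U : Prop := forall j, closure U j -> U j.

(** The white box of a lattice element is the element itself seen as a set, so
    that its left adjoint, the black diamond, is closure; the white diamond
    and the black box are the existential and the universal modality of the
    relation of being distinct.  Bottom is the least closed set, written so
    that it is closed whatever the number of points. *)
Fixpoint form_points (t : type) (A : form AtProp t) : AtProp -> Prop :=
  match A with
  | Atom p => fun j => p = j
  | Top => fun _ => True
  | Bot => distinct_within (fun _ => False)
  | BDia alpha => closure (form_points alpha)
  | BBox xi => distinct_within (form_points xi)
  | Box A => form_points A
  | Dia A => distinct_from_some (form_points A)
  | Cap s t => fun j => form_points s j /\ form_points t j
  | Cup s t => fun j => form_points s j \/ form_points t j
  end.

(** The comma, the units and [⊃] are read differently in the two positions: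
    [S ⊃ T] is the implication in succedent position and the difference
    [T] minus [S] in precedent position.  They must be, since the comma is
    conjunction in one position and disjunction in the other, and [⊃] is its
    residual in each. *)
Fixpoint struct_points (d : position) (t : type) (x : struct AtProp t) :
    AtProp -> Prop :=
  match x with
  | Fm A => form_points A
  | I => match d with
         | Precedent => form_points Top
         | Succedent => form_points Bot
         end
  | @Bullet _ Left y => closure (struct_points d y)
  | @Bullet _ Right y => distinct_within (struct_points d y)
  | Circ Left y => struct_points d y
  | Circ Right y => distinct_from_some (struct_points d y)
  | Unit => match d with
            | Precedent => fun _ => True
            | Succedent => fun _ => False
            end
  | Dot y z => match d with
               | Precedent => fun j => struct_points d y j /\ struct_points d z j
               | Succedent => fun j => struct_points d y j \/ struct_points d z j
               end
  | Imp y z => match d with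
               | Precedent =>
                   fun j => ~ struct_points Succedent y j /\ struct_points d z j
               | Succedent =>
                   fun j => struct_points Precedent y j -> struct_points d z j
               end
  end.

Definition valid (s : sequent AtProp) : Prop :=
  match s with
  | Seq x y => forall j, struct_points Precedent x j -> struct_points Succedent y j
  end.

(** * Closed sets *)

Lemma closure_extensive U j : U j -> closure U j.
Proof. intros Uj m jm. exists j. auto. Qed.

Lemma closure_mono U V :
  (forall j, U j -> V j) -> forall j, closure U j -> closure V j.
Proof.
  intros UV j Uj m jm. destruct (Uj m jm) as [k [Uk km]].
  exists k. auto.
Qed.

Lemma stable_distinct_within U : stable (distinct_within U).
Proof. intros j cj m jm. destruct (cj m jm) as [k [Uk km]]. exact (Uk m km). Qed.

(** This is why singletons are closed: a point other than [p] in the closure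
    of [p] would have [p] distinct from [p]. *)
Lemma stable_singleton p : stable (fun j => p = j).
Proof.
  intros j cj. apply NNPP. intros pj.
  destruct (cj p) as [k [pk kp]].
  - intros jp. apply pj. symmetry. exact jp.
  - apply kp. symmetry. exact pk.
Qed.

Lemma form_points_stable (t : type) (A : form AtProp t) :
  match t with TL => stable (form_points A) | TP _ => True end.
Proof.
  destruct A; cbn; trivial.
  - apply stable_singleton.
  - intros j _. trivial.
  - apply stable_distinct_within.
  - apply stable_distinct_within.
  - apply stable_distinct_within.
Qed.

(** Closure maps arbitrary sets to lattice elements with the inclusion as
    right adjoint, but only because lattice structures denote closed sets. *)
Lemma struct_points_stable (d : position) (t : type) (x : struct AtProp t) :
  match t with TL => stable (struct_points d x) | TP _ => True end.
Proof.
  destruct x as [t A| |[|] S|o X|o|o S T|o S T]; cbn; trivial.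
  - apply form_points_stable.
  - destruct d.
    + intros j _. trivial.
    + apply stable_distinct_within.
  - apply stable_distinct_within.
  - apply stable_distinct_within.
Qed.

Lemma bottom_least U : stable U -> forall j, form_points Bot j -> U j.
Proof. intros stU j bj. apply stU. intros m jm. destruct (bj m jm). Qed.

(** * Soundness *)

Lemma double_rule_sound (s r : sequent AtProp) :
  double_rule s r -> valid s <-> valid r.
Proof.
  intros []; cbn.
  - split; intros H j Gj.
    + apply (struct_points_stable Succedent X). revert Gj. apply closure_mono.
      exact H.
    + apply H. apply closure_extensive. exact Gj.
  - split; intros H.
    + intros j Xj m jm. apply H. exists j. auto.
    + intros m [j [Xj jm]]. exact (H j Xj m jm).
  - firstorder.
  - split; intros H j.
    + intros [nTj Sj]. destruct (H j Sj); tauto.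
    (* Moving a succedent to the left is where the sets must be Boolean. *)
    + intros Sj. destruct (classic (struct_points Succedent T j)); auto.
  - firstorder.
  - firstorder.
  - firstorder.
  - firstorder.
Qed.

Lemma rule_sound (ps : list (sequent AtProp)) (r : sequent AtProp) :
  rule ps r -> (forall s, In s ps -> valid s) -> valid r.
Proof.
  assert (one : forall s, (forall s', In s' (s :: nil) -> valid s') -> valid s)
    by (intros s H; apply H; left; reflexivity).
  assert (two : forall s1 s2, (forall s', In s' (s1 :: s2 :: nil) -> valid s') ->
            valid s1 /\ valid s2)
    by (intros s1 s2 H; split; apply H; cbn; auto).
  intros R H; destruct R;
    try apply one in H; try apply two in H; cbn in *; try (firstorder; fail).
  - apply (double_rule_sound H0). exact H.
  - apply (double_rule_sound H0). exact H.
  - intros j Xj. apply bottom_least.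
    + apply (struct_points_stable Succedent Y).
    + exact (H j Xj).
Qed.

Lemma soundness (s : sequent AtProp) : derivable s -> valid s.
Proof.
  induction 1 as [ps r R _ _ IH]. exact (rule_sound R IH).
Qed.

(** * The countermodel *)

(** No point is equal to both [p] and [q], so every point is distinct from one
    of them, which puts it in the white diamond of the union. *)
Lemma join_full p q j :
  p <> q -> form_points (tau_sup (LOr (LAtom p) (LAtom q))) j.
Proof.
  intros pq m jm. destruct (classic (p = m)) as [<-|pm].
  - exists q. split; [right; apply closure_extensive; reflexivity|auto].
  - exists p. split; [left; apply closure_extensive; reflexivity|exact pm].
Qed.

(** The black box distributes over the intersection, and on a white diamond it
    acts as closure, so a point of this set lies in both singletons. *)
Lemma meet_empty p q j :
  p <> q -> ~ form_points (tau_sub (LAnd (LAtom p) (LAtom q))) j.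
Proof.
  intros pq mj. apply pq. transitivity j.
  - apply stable_singleton. intros m jm. destruct (mj m jm) as [[k [pk km]] _].
    exists k. split; [apply stable_singleton; exact pk|exact km].
  - symmetry. apply stable_singleton. intros m jm.
    destruct (mj m jm) as [_ [k [qk km]]].
    exists k. split; [apply stable_singleton; exact qk|exact km].
Qed.

End Model.

Theorem mainTheorem5 (AtProp : Type) (a b c : AtProp)
    (hab : a <> b) (hac : a <> c) (hbc : b <> c) :
  ~ derivable
      (tau_sup (LAtom a ∧ (LAtom b ∨ LAtom c)) ⊢
       tau_sub ((LAtom a ∧ LAtom b) ∨ (LAtom a ∧ LAtom c)))%dll.
Proof.
  intros D. apply soundness in D.
  assert (precedent : form_points (tau_sup (LAnd (LAtom a) (LOr (LAtom b) (LAtom c)))) a).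
  { apply closure_extensive. split.
    - apply closure_extensive. reflexivity.
    - exact (join_full hbc). }
  (* The succedent is the black box of a set that ought to contain every point
     distinct from [a], such as [b], but is empty. *)
  destruct (D a precedent b hab) as [[j [mj _]]|[j [mj _]]].
  - exact (meet_empty hab mj).
  - exact (meet_empty hac mj).
Qed.
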